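(* Let $p$ be an odd prime and let $G$ be a finite metabelian $p$-group. If the nilpotency class of $G$ is less than or equal to $2p-1$, then $\exp(G\wedge G)$ divides $\exp(G)$. In particular, $\exp(H_2(G,\mathbb{Z}))$ divides $\exp(G)$.
   Context: $\exp(H)$ denotes the exponent of a finite group $H$, i.e. the least positive integer $e$ with $h^e=1$ for all $h\in H$. A group is metabelian if its commutator subgroup is abelian. $G\wedge G$ is the nonabelian exterior square of $G$: the group generated by symbols $g\wedge h$ ($g,h\in G$) subject to the relations $gg'\wedge h=({}^{g}g'\wedge {}^{g}h)(g\wedge h)$, $g\wedge hh'=(g\wedge h)({}^{h}g\wedge {}^{h}h')$ and $g\wedge g=1$ for all $g,g',h,h'\in G$, where ${}^{g}h=ghg^{-1}$. For finite $G$ it is isomorphic to the commutator subgroup $\gamma_2(H)$ of any covering group $H$ of $G$. $H_2(G,\mathbb{Z})$ is the second integral homology group (Schur multiplier) of $G$, which is isomorphic to the kernel of the commutator map $G\wedge G\to G$, $g\wedge h\mapsto ghg^{-1}h^{-1}$. *)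

(* Defs.v *)
From HB Require Import structures.
From mathcomp Require Import all_boot all_order all_algebra all_fingroup.
From mathcomp Require Import all_solvable.
From mathcomp Require Import boolp ring generic_quotient.

Set Implicit Arguments.
Unset Strict Implicit.
Unset Printing Implicit Defensive.

Import GRing.Theory.

Local Open Scope quotient_scope.

Definition least_pos (P : nat -> Prop) : nat :=
  if pselect (exists e, (0 < e) && `[< P e >]) is left exP then ex_minn exP
  else 0.

(* The exponent of a group type that is not known to be finite, in
   multiplicative and in additive notation. A group of infinite exponent gets
   the value 0, which divides no positive number. For a finite group given as a
   finGroupType, this is the library's [exponent]. *)
Definition gexponent (T : groupType) : nat :=
  least_pos (fun e => forall x : T, (x ^+ e = 1)%g).

Definition zexponent (V : zmodType) : nat :=
  least_pos (fun e => forall x : V, (x *+ e = 0)%R).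

Section Presentation.

Variable X : choiceType.

(* The letter (x, false) stands for x, and (x, true) for its inverse. *)
Definition word := seq (X * bool).

Definition word_inv (w : word) : word :=
  rev [seq (a.1, ~~ a.2) | a <- w].

Variable R : word -> word -> Prop.

(* The congruence on words defining the group < X | u = v for R u v >. *)
Inductive pres_eq : word -> word -> Prop :=
| PresRefl u : pres_eq u u
| PresSym u v : pres_eq u v -> pres_eq v u
| PresTrans u v w : pres_eq u v -> pres_eq v w -> pres_eq u w
| PresCat u u' v v' :
    pres_eq u u' -> pres_eq v v' -> pres_eq (u ++ v) (u' ++ v')
| PresCancel x b : pres_eq [:: (x, b); (x, ~~ b)] [::]
| PresRel u v : R u v -> pres_eq u v.

Definition pres_eqb : rel word := fun u v => `[< pres_eq u v >].

Lemma pres_eqb_equiv : equiv_class_of pres_eqb.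
Proof.
split=> [u|u v|v u w]; first by apply/asboolP; apply: PresRefl.
- by apply/asboolP/asboolP; apply: PresSym.
- by move=> /asboolP uv /asboolP vw; apply/asboolP; apply: PresTrans uv vw.
Qed.

Canonical pres_eqb_equiv_rel := EquivRelPack pres_eqb_equiv.

Definition pres_group := {eq_quot pres_eqb}.

HB.instance Definition _ := Choice.on pres_group.
HB.instance Definition _ := EqQuotient.on pres_group.

Lemma pres_groupP u v :
  reflect (pres_eq u v) (\pi_pres_group u == \pi_pres_group v).
Proof. by rewrite eqmodE; apply: asboolP. Qed.

Definition pres_one : pres_group := \pi_pres_group [::].
Definition pres_mul := lift_op2 pres_group (fun u v : word => u ++ v).
Definition pres_inv := lift_op1 pres_group word_inv.

Lemma pres_repr u : pres_eq (repr (\pi_pres_group u)) u.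
Proof. by apply/pres_groupP; rewrite reprK. Qed.

Lemma pres_mulE u v :
  pres_mul (\pi_pres_group u) (\pi_pres_group v) = \pi_pres_group (u ++ v).
Proof.
by unlock pres_mul; apply/eqP/pres_groupP; apply: PresCat; apply: pres_repr.
Qed.

Lemma pres_eq_inv (w : word) : pres_eq (word_inv w ++ w) [::].
Proof.
elim: w => [|[x b] w IHw]; first exact: PresRefl.
rewrite /word_inv /= rev_cons -cats1 -catA /=.
apply: PresTrans IHw; apply: PresCat; first exact: PresRefl.
rewrite -[in X in pres_eq X _]cat1s -cat_rcons -[X in pres_eq _ X]cat0s.
apply: PresCat; last exact: PresRefl.
by have := PresCancel x (~~ b); rewrite negbK.
Qed.

Lemma word_invK : involutive word_inv.
Proof.
move=> w; rewrite /word_inv map_rev revK -map_comp map_id_in // => -[x b] _.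
by rewrite /= negbK.
Qed.

Lemma pres_mulA : associative pres_mul.
Proof.
by elim/quotW=> u; elim/quotW=> v; elim/quotW=> w; rewrite !pres_mulE catA.
Qed.

Lemma pres_mul1g : left_id pres_one pres_mul.
Proof. by elim/quotW=> u; rewrite pres_mulE cat0s. Qed.

Lemma pres_mulg1 : right_id pres_one pres_mul.
Proof. by elim/quotW=> u; rewrite pres_mulE cats0. Qed.

Lemma pres_mulVg : left_inverse pres_one pres_inv pres_mul.
Proof.
move=> a; unlock pres_inv; rewrite -[X in pres_mul _ X]reprK pres_mulE.
by apply/eqP/pres_groupP/pres_eq_inv.
Qed.

Lemma pres_mulgV : right_inverse pres_one pres_inv pres_mul.
Proof.
move=> a; unlock pres_inv; rewrite -[X in pres_mul X _]reprK pres_mulE.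
apply/eqP/pres_groupP; rewrite -{1}[repr a]word_invK; exact: pres_eq_inv.
Qed.

HB.instance Definition _ := isGroup.Build pres_group
  pres_mulA pres_mul1g pres_mulg1 pres_mulVg pres_mulgV.

End Presentation.

Section ExteriorSquare.

Variable G : groupType.

Local Open Scope group_scope.

(* The symbol g /\ h, as a one-letter word. *)
Definition wdg (g h : G) : word (G * G)%type := [:: ((g, h), false)].

(* Left conjugation; the library's [h ^ g] is the right one, g^-1 * h * g. *)
Definition lconj (g h : G) : G := g * h * g^-1.

Inductive ext_rel : word (G * G)%type -> word (G * G)%type -> Prop :=
| ExtMull g g' h :
    ext_rel (wdg (g * g') h) (wdg (lconj g g') (lconj g h) ++ wdg g h)
| ExtMulr g h h' :
    ext_rel (wdg g (h * h')) (wdg g h ++ wdg (lconj h g) (lconj h h'))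
| ExtDiag g : ext_rel (wdg g g) [::].

Definition ext_square : groupType := pres_group ext_rel.

End ExteriorSquare.

Section SecondHomology.

Variable G : finGroupType.

Local Open Scope ring_scope.

(* The free abelian group on the finite set I. *)
Local Notation freeZ I := {ffun I -> int}.

Definition basisZ (I : finType) (i : I) : freeZ I := [ffun j => (j == i)%:R].

Definition extendZ (I : finType) (V : zmodType) (f : I -> V) (c : freeZ I) : V :=
  \sum_(i : I) f i *~ c i.

(* The inhomogeneous bar complex of G with trivial integer coefficients, in
   degrees 3, 2 and 1. *)
Definition bar_d2 : freeZ (G * G) -> freeZ G :=
  extendZ (fun x => let: (g, h) := x in
    basisZ h - basisZ (g * h)%g + basisZ g).

Definition bar_d3 : freeZ (G * G * G) -> freeZ (G * G) :=
  extendZ (fun x => let: (g, h, k) := x in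
    basisZ (h, k) - basisZ ((g * h)%g, k) + basisZ (g, (h * k)%g)
    - basisZ (g, h)).

Lemma extendZ_is_zmod_morphism (I : finType) (V : zmodType) (f : I -> V) :
  zmod_morphism (extendZ f).
Proof.
move=> c c'; rewrite /extendZ -sumrB; apply: eq_bigr => i _.
by rewrite !ffunE mulrzBr.
Qed.

HB.instance Definition _ := GRing.isZmodMorphism.Build _ _ bar_d2
  (extendZ_is_zmod_morphism _).
HB.instance Definition _ := GRing.isZmodMorphism.Build _ _ bar_d3
  (extendZ_is_zmod_morphism _).

Lemma extendZ_basis (I : finType) (V : zmodType) (f : I -> V) (i : I) :
  extendZ f (basisZ i) = f i.
Proof.
rewrite /extendZ (bigD1 i) //= big1 ?addr0 => [|j ji]; rewrite ffunE.
  by rewrite eqxx mulr1z.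
by rewrite (negPf ji) mulr0z.
Qed.

Lemma bar_d2_d3 c : bar_d2 (bar_d3 c) = 0.
Proof.
rewrite [bar_d3 c]/extendZ raddf_sum big1 // => -[[g h] k] _.
rewrite raddfMz !(raddfB, raddfD) /= /bar_d2 !extendZ_basis mulgA.
by rewrite [X in X *~ _](_ : _ = 0) ?mul0rz //; apply/ffunP => i;
  rewrite !ffunE; ring.
Qed.

Definition cycle2 : pred (freeZ (G * G)) := fun c => bar_d2 c == 0.

Lemma cycle2_zmod_closed : zmod_closed cycle2.
Proof.
split=> [|c c' /eqP dc /eqP dc']; apply/eqP; first exact: raddf0.
by rewrite raddfB /= dc dc' subr0.
Qed.

HB.instance Definition _ := GRing.isZmodClosed.Build _ cycle2 cycle2_zmod_closed.

Record Z2 := MkZ2 { cycle2_val :> freeZ (G * G); _ : cycle2_val \in cycle2 }.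

HB.instance Definition _ := [isSub for cycle2_val].
HB.instance Definition _ := [Choice of Z2 by <:].
HB.instance Definition _ := [SubChoice_isSubZmodule of Z2 by <:].

Definition boundary2 : pred Z2 := fun z => `[< exists b, bar_d3 b = val z >].

Lemma boundary2_zmod_closed : zmod_closed boundary2.
Proof.
split=> [|z z' /asboolP[b db] /asboolP[b' db']]; apply/asboolP.
  by exists 0; rewrite !raddf0.
by exists (b - b'); rewrite !raddfB /= db db'.
Qed.

HB.instance Definition _ :=
  GRing.isZmodClosed.Build _ boundary2 boundary2_zmod_closed.

Definition H2 : zmodType :=
  Quotient.quot (GRing.ZmodClosed.clone Z2 boundary2 _).

End SecondHomology.

(* Main.v *)
From HB Require Import structures.
Require Import Defs.
From mathcomp Require Import all_boot all_order all_algebra all_fingroup.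
From mathcomp Require Import all_solvable.
From mathcomp Require Import boolp zify generic_quotient.

Set Implicit Arguments.
Unset Strict Implicit.
Unset Printing Implicit Defensive.

Import GRing.Theory.

Local Open Scope quotient_scope.

(** Let $q$ be the exponent of $G$ and $X = G \wedge G$. The group $G$ acts on $X$,
   and the boundary $X \to G$ sends $g \wedge h$ to the commutator $[g, h]$.
   Together they form a crossed module: the boundary of $x$ acts on $X$ as
   conjugation by $x$ ([act_bd]), and wedging $g$ with the boundary of $x$ gives
   $(g x) x^(-1)$ ([wedge_bd]). Hence the kernel of the boundary is central in
   $X$ and fixed by $G$. As $G'$ is abelian, the kernel contains the commutators
   of $X$, so that $X$ has class at most two; these commutators have exponent
   dividing $q$, and as $q$ is odd, $x \mapsto x^q$ is an endomorphism of $X$.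
   It is therefore enough to show that $(g \wedge h)^q = 1$.

   The same data let $X$ be replaced by the additive group of its Baer Lie ring,
   on which $G$ acts by additive maps. Let $c = g \wedge h$ and let $f$ be the
   action of $g$. Then $g^q \wedge h = 1$ becomes a relation between the sum of
   $c, f c, ..., f^(q-1) c$ and the bracket with $c$ of a sum of such partial sums
   ([wedge_expl]). Sums of powers of $f$ are polynomials in $f - 1$ with
   binomial coefficients $C(q, k)$. The bound on the class kills the powers from
   the exponent $2p - 1$ on, and among the $C(q, k)$ with $0 < k < 2p$ only
   $C(q, p)$ is not a multiple of $q$. So all sums of length $q$ turn into
   $C(q, p)$ times sums of length $p$ ([iter_sum_reduce]): up to this factor one
   works in a group of exponent $p$.

   What is then needed is the Engel identity of metabelian groups of exponent
   $p$, multiplied by $C(q, p)$ ([engel_p]). It removes the bracket and all other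
   terms of the relation except $q c$, provided that $q (f c - c) = 0$, which
   says that $(g \wedge [g, h])^q = 1$. A descending induction along the lower
   central series completes the argument for $X$ ([ext_square_expq]).

   For the homology group, let $E$ be the central extension of $G$ defined by the
   universal 2-cocycle, with values in the 2-chains modulo boundaries.
   Commutators of lifts map $X$ onto $[E, E]$. The abelian group $E / [E, E]$ sees
   a 2-chain only through its boundary ([derived_classE]), so that every 2-cycle
   lies in $[E, E]$, and has order dividing $q$ ([H2_expq]). *)

(** * Sums of powers of an additive map *)

Section IteratedSums.

Local Open Scope ring_scope.

Implicit Types V : zmodType.

Definition delta V (f : V -> V) (v : V) : V := f v - v.

Fact delta_is_zmod_morphism V (f : {additive V -> V}) :
  zmod_morphism (delta f).
Proof. by move=> u v; rewrite /delta raddfB !opprD !opprK addrACA. Qed.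

HB.instance Definition _ V (f : {additive V -> V}) :=
  GRing.isZmodMorphism.Build V V (delta f) (delta_is_zmod_morphism f).

Definition iter_sum V (f : V -> V) n v : V := \sum_(i < n) iter i f v.

Definition iter_sum2 V (f : V -> V) n v : V := \sum_(i < n) iter_sum f i v.

Lemma iter_additiveB V (f : {additive V -> V}) n : zmod_morphism (iter n f).
Proof. by elim: n => // n IHn u v; rewrite /= IHn raddfB. Qed.

Fact iter_sum_is_zmod_morphism V (f : {additive V -> V}) n :
  zmod_morphism (iter_sum f n).
Proof.
move=> u v; rewrite /iter_sum -sumrB; apply: eq_bigr => i _.
exact: iter_additiveB.
Qed.

HB.instance Definition _ V (f : {additive V -> V}) n :=
  GRing.isZmodMorphism.Build V V (iter_sum f n) (iter_sum_is_zmod_morphism f n).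

Fact iter_sum2_is_zmod_morphism V (f : {additive V -> V}) n :
  zmod_morphism (iter_sum2 f n).
Proof.
by move=> u v; rewrite /iter_sum2 -sumrB; apply: eq_bigr => i _; rewrite raddfB.
Qed.

HB.instance Definition _ V (f : {additive V -> V}) n :=
  GRing.isZmodMorphism.Build V V (iter_sum2 f n)
    (iter_sum2_is_zmod_morphism f n).

Lemma iter_sum0 V (f : V -> V) v : iter_sum f 0 v = 0.
Proof. by rewrite /iter_sum big_ord0. Qed.

Lemma iter_sumSr V (f : V -> V) n v :
  iter_sum f n.+1 v = iter_sum f n v + iter n f v.
Proof. by rewrite /iter_sum big_ord_recr. Qed.

Lemma iter_sumSl V (f : {additive V -> V}) n v :
  iter_sum f n.+1 v = v + f (iter_sum f n v).
Proof. by rewrite /iter_sum big_ord_recl raddf_sum. Qed.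

Lemma iter_sumD V (f : V -> V) m n v :
  iter_sum f (m + n) v = iter_sum f m v + iter_sum f n (iter m f v).
Proof.
rewrite /iter_sum big_split_ord /=; congr (_ + _).
by apply: eq_bigr => i _; rewrite addnC iterD.
Qed.

Lemma iter_sum2S V (f : V -> V) n v :
  iter_sum2 f n.+1 v = iter_sum2 f n v + iter_sum f n v.
Proof. by rewrite /iter_sum2 big_ord_recr. Qed.

Lemma intertwine_iter V (W : zmodType) (F : V -> W) (f : V -> V) (g : W -> W) :
    (forall v, F (f v) = g (F v)) ->
  forall n v, F (iter n f v) = iter n g (F v).
Proof. by move=> Ffg; elim=> //= n IHn v; rewrite Ffg IHn. Qed.

Lemma intertwine_iter_sum V (W : zmodType)
    (F : {additive V -> W}) (f : V -> V) (g : W -> W) :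
    (forall v, F (f v) = g (F v)) ->
  forall n v, F (iter_sum f n v) = iter_sum g n (F v).
Proof.
move=> Ffg n v; rewrite /iter_sum raddf_sum; apply: eq_bigr => i _.
exact: intertwine_iter.
Qed.

Lemma intertwine_iter_sum2 V (W : zmodType)
    (F : {additive V -> W}) (f : V -> V) (g : W -> W) :
    (forall v, F (f v) = g (F v)) ->
  forall n v, F (iter_sum2 f n v) = iter_sum2 g n (F v).
Proof.
move=> Ffg n v; rewrite /iter_sum2 raddf_sum; apply: eq_bigr => i _.
exact: intertwine_iter_sum.
Qed.

Lemma intertwine_delta V (W : zmodType)
    (F : {additive V -> W}) (f : V -> V) (g : W -> W) :
  (forall v, F (f v) = g (F v)) -> forall v, F (delta f v) = delta g (F v).
Proof. by move=> Ffg v; rewrite /delta raddfB Ffg. Qed.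

Lemma iter_sum_delta V (f : {additive V -> V}) n v :
  iter_sum f n (delta f v) = iter n f v - v.
Proof.
elim: n => [|n IHn]; first by rewrite iter_sum0 subrr.
by rewrite iter_sumSr IHn iter_additiveB -iterSr addrC addrA subrK.
Qed.

Lemma iter_sum_iter_sum2 V (f : {additive V -> V}) n v :
  iter_sum f n v = v *+ n + iter_sum2 f n (delta f v).
Proof.
elim: n => [|n IHn]; first by rewrite iter_sum0 add0r /iter_sum2 big_ord0.
rewrite iter_sumSr IHn iter_sum2S iter_sum_delta mulrSr.
by rewrite addrACA [v + _]addrC subrK.
Qed.

Lemma mulrn_dvd0 V (v : V) m n :
  (m %| n)%N -> v *+ m = 0 -> v *+ n = 0.
Proof. by move=> /dvdnP[k ->] v0; rewrite mulnC mulrnA v0 mul0rn. Qed.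

Lemma iter_deltaMn V (f : {additive V -> V}) k v n :
  iter k (delta f) v *+ n = iter k (delta f) (v *+ n).
Proof. by elim: k v => //= k IHk v; rewrite -raddfMn IHk. Qed.

Lemma iter_delta0 V (f : {additive V -> V}) k :
  iter k (delta f) 0 = 0.
Proof. by elim: k => //= k ->; rewrite raddf0. Qed.

(** With $d = f - 1$ this is $1 + f + ... + f^(n-1) = ((1 + d)^n - 1) / d$. *)
Lemma iter_sum_newton V (f : {additive V -> V}) M v :
    iter M (delta f) v = 0 ->
  forall n, iter_sum f n v = \sum_(k < M) iter k (delta f) v *+ 'C(n, k.+1).
Proof.
move=> dM0; elim=> [|n IHn].
  by rewrite iter_sum0 big1 // => k _; rewrite bin0n.
have fE u : f u = u + delta f u by rewrite /delta addrC subrK.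
rewrite iter_sumSl fE [in LHS]IHn addrCA.
under [RHS]eq_bigr do rewrite binS mulrnDr.
rewrite big_split; congr (_ + _) => /=.
have -> : \sum_(k < M) iter k (delta f) v *+ 'C(n, k)
        = \sum_(k < M.+1) iter k (delta f) v *+ 'C(n, k).
  by rewrite big_ord_recr /= dM0 mul0rn addr0.
rewrite big_ord_recl bin0; congr (_ + _).
by rewrite raddf_sum; apply: eq_bigr => k _; rewrite raddfMn.
Qed.

End IteratedSums.

Section PrimePowerReduction.

Variables p q : nat.
Hypotheses (p_prime : prime p) (q_pnat : p.-nat q).

Lemma dvdn_bin_pnat k : 0 < k < 2 * p -> k != p -> q %| 'C(q, k).
Proof.
case: k => // k /andP[_ k_lt] k_p.
have/p_natP[n qE] := q_pnat.
have cop : coprime q k.+1.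
  rewrite qE coprimeXl // prime_coprime //; apply/negP=> /dvdnP[[|[|m]] E] //.
    by rewrite E mul1n eqxx in k_p.
  by move: k_lt; rewrite E ltn_mul2r !ltnS ltn0 andbF.
by rewrite -(Gauss_dvdr _ cop) -mul_bin_diag dvdn_mulr.
Qed.

Lemma dvdn_bin_prime_mul : q %| p * 'C(q, p).
Proof.
have := mul_bin_diag q p.-1; rewrite prednK ?prime_gt0 // => <-.
by rewrite dvdn_mulr.
Qed.

Local Open Scope ring_scope.

(** Modulo $q$ only the coefficient $C(q, p)$ of Newton's expansion survives,
   and it multiplies $d^(p-1)$, where $d = f - 1$. As $q$ divides $p C(q, p)$,
   the sum of the first $p$ powers of $f$, which is $d^(p-1)$ modulo $p$, may
   stand in for $d^(p-1)$. *)
Lemma iter_sum_reduce (V : zmodType) (f : {additive V -> V}) (v : V) :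
    v *+ q = 0 -> iter (2 * p).-1 (delta f) v = 0 ->
  iter_sum f q v = iter_sum f p v *+ 'C(q, p).
Proof.
move=> vq dM0; rewrite !(iter_sum_newton dM0) -sumrMnl; apply: eq_bigr => k _.
have p_gt0 := prime_gt0 p_prime.
have k_lt : (k.+1 < 2 * p)%N by have := ltn_ord k; lia.
have [kp | kp] := eqVneq k.+1 p.
  by rewrite kp binn mulr1n.
rewrite [LHS](mulrn_dvd0 (dvdn_bin_pnat _ kp)) ?k_lt //; last first.
  by rewrite iter_deltaMn vq iter_delta0.
rewrite -mulrnA [RHS](@mulrn_dvd0 _ _ q) //; last first.
  by rewrite iter_deltaMn vq iter_delta0.
have [k_ltp | k_gtp] := ltnP k.+1 p; last first.
  by rewrite bin_small ?mul0n ?ltn_neqAle 1?eq_sym ?kp.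
apply: dvdn_trans dvdn_bin_prime_mul _; rewrite dvdn_mul //.
by rewrite prime_dvd_bin.
Qed.

(** The powers of this triangular operator have the sums
   $\sum_i f^(n-1-i) g^i$ as off-diagonal entries, so that results on one
   operator apply to sums over two. *)
Definition skew (V : zmodType) (f g : V -> V) (u : V * V) : V * V :=
  (f u.1 + u.2, g u.2).

Fact skew_is_zmod_morphism (V : zmodType) (f g : {additive V -> V}) :
  zmod_morphism (skew f g).
Proof.
move=> [a b] [a' b']; rewrite /skew /= !raddfB; congr (_, _).
by rewrite /= opprD addrACA.
Qed.

HB.instance Definition _ (V : zmodType) (f g : {additive V -> V}) :=
  GRing.isZmodMorphism.Build _ _ (skew f g) (skew_is_zmod_morphism f g).

Lemma iter_sum2_reduce (V : zmodType) (f : {additive V -> V}) (v : V) :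
    v *+ q = 0 -> iter (2 * p - 2)%N (delta f) v = 0 ->
  iter_sum2 f q v = iter_sum2 f p v *+ 'C(q, p).
Proof.
move=> vq dM0.
have p_gt0 := prime_gt0 p_prime.
pose h := skew idfun f; pose w : V * V := (0, v).
have itE n : iter n h w = (iter_sum f n v, iter n f v).
  by elim: n => [|n IHn]; rewrite ?iter_sum0 //= IHn iter_sumSr.
have sumE n : (iter_sum h n w).1 = iter_sum2 f n v.
  rewrite /iter_sum /iter_sum2 raddf_sum /=; apply: eq_bigr => i _.
  by rewrite itE.
have dE n : iter n.+1 (delta h) w = (iter n (delta f) v, iter n.+1 (delta f) v).
  elim: n => [|n IHn].
    by rewrite /= /delta /skew /=; congr (_, _); rewrite /= ?subr0 add0r.
  rewrite iterS IHn /delta /skew /=; congr (_, _).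
  by rewrite addrAC subrr add0r.
have wq : w *+ q = 0.
  rewrite [LHS]surjective_pairing (raddfMn (@fst V V)) (raddfMn (@snd V V)).
  by rewrite /= mul0rn vq.
rewrite -!sumE iter_sum_reduce //.
  by rewrite (raddfMn (@fst V V)).
have -> : (2 * p).-1 = (2 * p - 2).+1 by have := prime_gt1 p_prime; lia.
by rewrite dE /= dM0 raddf0.
Qed.

End PrimePowerReduction.

(** * The Engel identity in a metabelian group *)

Section Engel.

Variables (p q : nat) (T : groupType) (A : zmodType).
Variable act : T -> {additive A -> A}.
(* Below, A is the derived subgroup of T, comm is the commutator and Fil k is
   membership in term k + 2 of the lower central series. *)
Variables (comm : T -> T -> A) (Fil : nat -> A -> Prop).

Local Open Scope ring_scope.

Hypotheses (p_prime : prime p) (q_pnat : p.-nat q).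
Hypothesis act1 : forall a, act 1%g a = a.
Hypothesis actM : forall x y a, act (x * y)%g a = act x (act y a).
Hypothesis actC : forall x y a, act x (act y a) = act y (act x a).
Hypothesis commMr : forall y x x',
  comm y (x * x')%g = comm y x + act x (comm y x').
Hypothesis FilT : forall a, Fil 0 a.
Hypothesis FilD : forall k a b, Fil k a -> Fil k b -> Fil k (a + b).
Hypothesis FilS : forall k x a, Fil k a -> Fil k.+1 (delta (act x) a).
Hypothesis Fil_trivial : forall k a, (2 * p - 2 <= k)%N -> Fil k a -> a = 0.
Hypothesis expA : forall a : A, a *+ q = 0.
(* For a in A and x, y in T these two say that (a x)^q = 1 and (x y)^q = 1. *)
Hypothesis norm_q : forall x a, iter_sum (act x) q a = 0.
Hypothesis power_q : forall x y,
  \sum_(i < q) act (x ^+ i)%g (iter_sum (act y) i (comm y x)) = 0.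

Let p_gt1 := prime_gt1 p_prime.

Lemma iter_act n x a : iter n (act x) a = act (x ^+ n)%g a.
Proof. by elim: n => [|n IHn]; rewrite ?act1 //= IHn expgS actM. Qed.

Lemma act_expM n x y a :
  act ((x * y) ^+ n)%g a = act (x ^+ n)%g (act (y ^+ n)%g a).
Proof.
elim: n => [|n IHn]; first by rewrite !expg0 !act1.
by rewrite !expgS !actM IHn [act y _]actC.
Qed.

Lemma act_inj x a : act x a = 0 -> a = 0.
Proof. by move=> xa0; rewrite -[a]act1 -(mulVg x) actM xa0 raddf0. Qed.

Lemma iter_delta_act_eq0 n x a :
  (2 * p - 2 <= n)%N -> iter n (delta (act x)) a = 0.
Proof.
move=> p_n; apply: Fil_trivial p_n _.
by elim: n => [|n IHn] /=; [apply: FilT | apply: FilS].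
Qed.

Lemma norm_p x a : iter_sum (act x) p a *+ 'C(q, p) = 0.
Proof.
rewrite -(iter_sum_reduce p_prime q_pnat) ?norm_q //.
by rewrite iter_delta_act_eq0 //; lia.
Qed.

(** The sum is the first component of an orbit sum of a triangular operator on
   $A \times A$, to which the reduction applies like in [norm_p]. *)
Lemma power_p x y :
  (\sum_(i < p) act (x ^+ i)%g (iter_sum (act y) i (comm y x))) *+ 'C(q, p) = 0.
Proof.
pose h := skew (act x) (act (x * y)%g); pose w : A * A := (0, act x (comm y x)).
have itE n : iter n h w = (act (x ^+ n)%g (iter_sum (act y) n (comm y x)),
                           act ((x * y) ^+ n)%g (act x (comm y x))).
  elim: n => [|n IHn]; first by rewrite iter_sum0 raddf0 /= expg0 act1.
  rewrite iterS IHn /h /skew /= !expgS !actM act_expM; congr (_, _).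
  rewrite iter_sumSr raddfD raddfD iter_act; congr (_ + _).
  by rewrite [in RHS]actC [act (y ^+ n)%g _]actC actC.
have sumE n : (iter_sum h n w).1 =
    \sum_(i < n) act (x ^+ i)%g (iter_sum (act y) i (comm y x)).
  by rewrite /iter_sum raddf_sum /=; apply: eq_bigr => i _; rewrite itE.
have hFil n : let u := iter n.+1 (delta h) w in Fil n u.1 /\ Fil n.+1 u.2.
  elim: n => [|n [IH1 IH2]] /=.
    by split; [apply: FilT | apply: FilS; apply: FilT].
  split; last exact: FilS.
  by rewrite addrAC; apply: FilD => //; apply: FilS.
have wq : w *+ q = 0.
  rewrite [LHS]surjective_pairing (raddfMn (@fst A A)) (raddfMn (@snd A A)).
  by rewrite !expA.
rewrite -sumE -(raddfMn (@fst A A)) -(iter_sum_reduce p_prime q_pnat) //.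
  exact: etrans (sumE q) (power_q x y).
have -> : (2 * p).-1 = (2 * p - 2).+1 by lia.
have [] := hFil (2 * p - 2)%N.
case: (iter _ _ _) => a b /= /Fil_trivial-> // /Fil_trivial-> //.
Qed.

Lemma comm_expr y x n : comm y (x ^+ n)%g = iter_sum (act x) n (comm y x).
Proof.
elim: n => [|n IHn].
  rewrite iter_sum0; have := commMr y 1%g 1%g.
  rewrite mulg1 act1 => /(congr1 (fun a => a - comm y 1%g)).
  by rewrite subrr addrK => /esym.
by rewrite expgS commMr IHn iter_sumSl.
Qed.

(** The partial norms of $x$ are periodic because the full one vanishes. *)
Lemma iter_sum_modn x n a :
  iter_sum (act x) (n %% p) a *+ 'C(q, p) = iter_sum (act x) n a *+ 'C(q, p).
Proof.
rewrite {2}(divn_eq n p) addnC; elim: (n %/ p)%N => [|m IHm].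
  by rewrite mul0n addn0.
by rewrite mulSn addnCA addnC iter_sumD mulrnDl norm_p addr0.
Qed.

Lemma sum_iter_sum_mul x m a : ~~ (p %| m)%N ->
  (\sum_(s < p) iter_sum (act x) (s * m) a) *+ 'C(q, p) =
  iter_sum2 (act x) p a *+ 'C(q, p).
Proof.
move=> p_m; have p_gt0 : (0 < p)%N by lia.
pose h (s : 'I_p) := Ordinal (ltn_pmod (s * m) p_gt0).
have h_inj : injective h.
  have aux (s t : 'I_p) : (t <= s)%N -> h s = h t -> s = t.
    move=> ts /(congr1 val)/eqP; rewrite /= eqn_mod_dvd ?leq_mul // -mulnBl.
    rewrite Euclid_dvdM // (negPf p_m) orbF => /dvdnP[[|k] E]; apply: val_inj.
      by move: ts E; rewrite /=; lia.
    by have := ltn_ord s; move: E; rewrite mulSn; lia.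
  move=> s t; case/orP: (leq_total t s) => [|st] st' //; first exact: aux.
  by apply/esym/aux.
rewrite /iter_sum2 [in RHS](reindex_inj h_inj) -!sumrMnl.
by apply: eq_bigr => s _; rewrite /= iter_sum_modn.
Qed.

(** Multiplied by $C(q, p)$, this is the identity $[y, x, ..., x] = 1$, with
   $p - 1$ entries $x$, of metabelian groups of exponent $p$; the factor is
   omitted below. Let $[n]_z = 1 + z + ... + z^(n-1)$ and $c = [y, x]$. The relation that
   [power_p] gives for $x^s$ and $y$ is
   $\sum_i [i]_y ([s(i+1)]_x - [si]_x) c = 0$. Sum it over all $s$ modulo $p$:
   by periodicity both $[s(i+1)]_x$ and $[si]_x$ run through all $[r]_x$, and
   cancel, unless $i = p - 1$, or $i = 0$ when $[i]_y = 0$. What remains is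
   $[p-1]_y \sum_r [r]_x c = 0$, and $[p-1]_y = [p]_y - y^(p-1)$ is
   invertible since the norm $[p]_y$ vanishes. *)
Lemma engel_p x y : iter_sum2 (act x) p (comm y x) *+ 'C(q, p) = 0.
Proof.
set c := comm y x; set k := 'C(q, p); set t := _ *+ k.
pose g m := (\sum_(s < p) iter_sum (act x) (s * m) c) *+ k.
have gN m : ~~ (p %| m)%N -> g m = t by exact: sum_iter_sum_mul.
have g_p : g p = 0.
  rewrite /g -sumrMnl big1 // => s _.
  by rewrite -iter_sum_modn modnMl iter_sum0 mul0rn.
have actP m i : act (x ^+ m)%g (iter_sum (act x) i c) =
    iter_sum (act x) (m + i) c - iter_sum (act x) m c.
  rewrite iter_sumD [X in X - _]addrC addrK iter_act.
  by apply: (@intertwine_iter_sum _ _ (act (x ^+ m)%g)) => a; rewrite actC.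
have : \sum_(i < p) iter_sum (act y) i (g i.+1 - g i) = 0.
  transitivity (\sum_(s < p) (\sum_(i < p) act ((x ^+ s) ^+ i)%g
      (iter_sum (act y) i (comm y (x ^+ s)%g))) *+ k); last first.
    by apply: big1 => s _; apply: power_p.
  under [RHS]eq_bigr do rewrite -sumrMnl.
  rewrite exchange_big; apply: eq_bigr => i _ /=.
  rewrite /g -mulrnBl -sumrB raddfMn raddf_sum -sumrMnl.
  apply: eq_bigr => s _; congr (_ *+ _).
  rewrite comm_expr -expgnA.
  rewrite [RHS](@intertwine_iter_sum _ _ (act _) _ (act y)) => [|a].
    by rewrite actP mulnS addnC.
  exact: actC.
have t_norm n :
    iter_sum (act y) n.+1 t = iter_sum (act y) n t + act (y ^+ n)%g t.
  by rewrite iter_sumSr iter_act.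
have t_p : iter_sum (act y) p t = 0 by rewrite raddfMn /= norm_p.
have [r pE] : exists r, p = r.+2 by exists (p - 2)%N; lia.
have p_r m : (0 < m <= r.+1)%N -> ~~ (p %| m)%N.
  by move=> /andP[m_gt0 m_r]; apply/negP=> /(dvdn_leq m_gt0); lia.
rewrite -(big_mkord xpredT (fun i => iter_sum (act y) i (g i.+1 - g i))).
rewrite {1}pE big_nat_recr //= big_nat big1 => [|[|i] ir]; last first.
- by rewrite !gN ?subrr ?raddf0 ?p_r //; lia.
- by rewrite iter_sum0.
rewrite add0r -pE g_p sub0r gN; last by rewrite p_r // leqnn.
rewrite raddfN => /eqP.
rewrite oppr_eq0 => /eqP t0.
by move: t_p; rewrite pE t_norm t0 add0r => /act_inj.
Qed.

End Engel.

(** * The Lie ring of a group of class two *)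

Section BaerGroup.

Local Open Scope group_scope.

Definition lcomm (H : groupType) (x y : H) : H := x * y * x^-1 * y^-1.

(** Class at most two, with $z^r$ a square root of every commutator $z$. *)
Definition baer_cond (H : groupType) r :=
  (forall x y z : H, commute (lcomm x y) z) /\
  (forall x y : H, lcomm x y ^+ (r + r) = lcomm x y).

Variables (H : groupType) (r : nat).

Lemma lcommV (x y : H) : (lcomm x y)^-1 = lcomm y x.
Proof. by rewrite /lcomm !invgM !invgK !mulgA. Qed.

Lemma lcommK (x y : H) : lcomm x y * y * x = x * y.
Proof. by rewrite /lcomm !mulgVK. Qed.

Lemma commute_lcomm1 (x y : H) : commute x y -> lcomm x y = 1.
Proof. by move=> xy; rewrite /lcomm xy mulgK mulgV. Qed.

Definition baer_add (x y : H) : H := lcomm y x ^+ r * x * y.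

Hypothesis lcommC : forall x y z : H, commute (lcomm x y) z.

Lemma lcommMl (x y z : H) : lcomm (x * y) z = lcomm x z * lcomm y z.
Proof.
rewrite lcommC; transitivity (x * lcomm y z * x^-1 * lcomm x z).
  by rewrite /lcomm !invgM !mulgA !mulgVK.
by rewrite -(lcommC y z x) mulgK.
Qed.

Lemma lcommMr (x y z : H) : lcomm z (x * y) = lcomm z x * lcomm z y.
Proof. by apply: invg_inj; rewrite lcommV lcommMl invgM !lcommV lcommC. Qed.

Lemma lcommXl (x y : H) n : lcomm (x ^+ n) y = lcomm x y ^+ n.
Proof.
elim: n => [|n IHn]; first by rewrite commute_lcomm1 //; apply/commute_sym/commute1.
by rewrite !expgS lcommMl IHn.
Qed.

Lemma lcommXl_r (x y z : H) n : lcomm (lcomm x y ^+ n) z = 1.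
Proof.
by apply: commute_lcomm1; apply/commute_sym/commuteX/commute_sym/lcommC.
Qed.

Lemma lcommXr_r (x y z : H) n : lcomm z (lcomm x y ^+ n) = 1.
Proof. by apply: commute_lcomm1; apply/commuteX/commute_sym/lcommC. Qed.

Let lcommXC (x y z : H) n : lcomm x y ^+ n * z = z * lcomm x y ^+ n.
Proof. by apply/commute_sym/commuteX/commute_sym/lcommC. Qed.

Lemma baer_addA : associative baer_add.
Proof.
move=> x y z; rewrite /baer_add.
rewrite !lcommMr !lcommMl lcommXl_r lcommXr_r !mul1g.
have aC := lcommXC y x; have bC := lcommXC z x; have cC := lcommXC z y.
rewrite (expgMn _ (lcommC y x _)) (expgMn _ (lcommC z x _)).
set a := lcomm y x ^+ r; set b := lcomm z x ^+ r; set c := lcomm z y ^+ r.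
rewrite !mulgA; congr (_ * y * z).
by rewrite -!mulgA -[x * c]cC !mulgA; congr (_ * x); rewrite -[in LHS]mulgA aC.
Qed.

Hypothesis lcomm_double : forall x y : H, lcomm x y ^+ (r + r) = lcomm x y.

Lemma baer_addC : commutative baer_add.
Proof.
move=> x y; rewrite /baer_add -(lcommV x y).
move: (lcomm x y) (lcommK x y) (lcomm_double x y) => a aE a2.
by rewrite -!mulgA -aE !mulgA -{2}a2 expVgn expgnDr !mulgA mulVg mul1g.
Qed.

Lemma baer_add1g : left_id 1 baer_add.
Proof.
move=> x; rewrite /baer_add commute_lcomm1; last exact: commute1.
by rewrite expg1n !mul1g.
Qed.

Lemma baer_addVg : left_inverse 1 (fun x => x^-1) baer_add.
Proof.
move=> x; rewrite /baer_add commute_lcomm1; last exact/commuteV/commute_refl.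
by rewrite expg1n mul1g mulVg.
Qed.

End BaerGroup.

Lemma lcomm_morph (H H' : groupType) (f : UMagmaMorphism.type H H') x y :
  f (lcomm x y) = lcomm (f x) (f y).
Proof. by rewrite /lcomm !gmulfM !gmulfV. Qed.

(** Carrier of the Lie ring that Baer attaches to a group of class two: $x + y$
   is the symmetrized product $[y, x]^(1/2) x y$, and the bracket is the
   commutator. Powers and multiples agree, and so do group and ring
   endomorphisms. *)
Definition baer (H : groupType) r (cH : baer_cond H r) : Type := H.

Section BaerModule.

Variables (H : groupType) (r : nat) (cH : baer_cond H r).

HB.instance Definition _ := Choice.copy (baer cH) H.
HB.instance Definition _ := GRing.isZmodule.Build (baer cH)
  (@baer_addA H r (proj1 cH)) (@baer_addC H r (proj2 cH))
  (@baer_add1g H r) (@baer_addVg H r).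

Definition to_baer (x : H) : baer cH := x.
Definition of_baer (v : baer cH) : H := v.

Local Open Scope ring_scope.

Definition bracket (u v : baer cH) := to_baer (lcomm (of_baer u) (of_baer v)).

Lemma to_baerK : cancel to_baer of_baer. Proof. by []. Qed.
Lemma of_baerK : cancel of_baer to_baer. Proof. by []. Qed.

Lemma to_baer1 : to_baer 1%g = 0. Proof. by []. Qed.

Lemma of_baerD u v : of_baer (u + v) =
  (lcomm (of_baer v) (of_baer u) ^+ r * of_baer u * of_baer v)%g.
Proof. by []. Qed.

Lemma to_baerM_commute x y :
  commute x y -> to_baer (x * y)%g = to_baer x + to_baer y.
Proof.
move=> xy; apply: (can_inj of_baerK).
by rewrite of_baerD !to_baerK commute_lcomm1 // expg1n mul1g.
Qed.

Lemma to_baerX x n : to_baer (x ^+ n)%g = to_baer x *+ n.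
Proof.
elim: n => // n IHn; rewrite expgS to_baerM_commute ?IHn ?mulrS //.
exact/commuteX/commute_refl.
Qed.

Lemma to_baerM x y : to_baer (x * y)%g =
  to_baer x + to_baer y + bracket (to_baer x) (to_baer y) *+ r.
Proof.
have C n (a b z : H) : commute (lcomm a b ^+ n)%g z.
  by apply/commute_sym/commuteX/commute_sym; apply: (proj1 cH).
rewrite /bracket -to_baerX addrC; set u := to_baer x + to_baer y.
rewrite -(@to_baerM_commute _ (of_baer u)) ?of_baerD; last exact: C.
rewrite !to_baerK -(lcommV x y) expVgn; congr to_baer.
by rewrite !mulgA mulgV mul1g.
Qed.

Lemma bracketDl u v w : bracket (u + v) w = bracket u w + bracket v w.
Proof.
rewrite /bracket of_baerD !(lcommMl (proj1 cH)) (lcommXl_r (proj1 cH)) mul1g.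
by rewrite to_baerM_commute //; apply: (proj1 cH).
Qed.

Lemma bracket_lcomm0 u v w n : bracket (bracket u v *+ n) w = 0.
Proof. by rewrite /bracket -to_baerX to_baerK (lcommXl_r (proj1 cH)). Qed.

Lemma bracket0l v : bracket 0 v = 0.
Proof. by apply: (addrI (bracket 0 v)); rewrite addr0 -bracketDl addr0. Qed.

End BaerModule.

Section BaerFunctor.

Variables (H H' : groupType) (r : nat).
Variables (cH : baer_cond H r) (cH' : baer_cond H' r).

Definition baer_map (f : H -> H') (v : baer cH) : baer cH' :=
  to_baer cH' (f (of_baer v)).

Fact baer_map_is_nmod_morphism (f : UMagmaMorphism.type H H') :
  nmod_morphism (baer_map f).
Proof.
split=> [|u v]; rewrite /baer_map; first exact: gmulf1.
apply: (can_inj (@of_baerK _ _ cH')); rewrite !of_baerD to_baerK.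
by rewrite !gmulfM gmulfXn lcomm_morph.
Qed.

HB.instance Definition _ (f : UMagmaMorphism.type H H') :=
  GRing.isNmodMorphism.Build _ _ (baer_map f) (baer_map_is_nmod_morphism f).

End BaerFunctor.

(** * The exterior square as a crossed module *)

Notation "{ 'gmorph' H -> H' }" := (UMagmaMorphism.type H H')
  (H at level 98, H' at level 99, format "{ 'gmorph'  H  ->  H' }") : type_scope.

Section PresentationTheory.

Local Open Scope group_scope.

Variables (X : choiceType) (R : word X -> word X -> Prop).

Definition pgen (x : X) : pres_group R := \pi_(pres_group R) [:: (x, false)].

Lemma pi_cat (u v : word X) :
  \pi_(pres_group R) (u ++ v) = \pi_(pres_group R) u * \pi_(pres_group R) v.
Proof. by rewrite -pres_mulE. Qed.

Lemma pi_nil : \pi_(pres_group R) [::] = 1.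
Proof. by []. Qed.

Lemma pi_rel u v : R u v -> \pi_(pres_group R) u = \pi_(pres_group R) v.
Proof. by move=> Ruv; apply/eqP/pres_groupP/PresRel. Qed.

Lemma pi_letter x b :
  \pi_(pres_group R) [:: (x, b)] = if b then (pgen x)^-1 else pgen x.
Proof.
case: b => //; apply/esym/mulg1_eq.
by rewrite -pi_cat; apply/eqP/pres_groupP/(PresCancel _ x false).
Qed.

Lemma pres_group_ind (P : pres_group R -> Prop) :
    P 1 -> (forall x, P (pgen x)) -> (forall a b, P a -> P b -> P (a * b)) ->
    (forall a, P a -> P a^-1) ->
  forall a, P a.
Proof.
move=> P1 Pgen PM PV; elim/quotW; elim=> [|[x b] w IHw]; first exact: P1.
rewrite -cat1s pi_cat pi_letter; apply: (PM) => //.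
by case: b; [apply: PV|]; apply: Pgen.
Qed.

Lemma eq_pres_morph (H : groupType) (f g : {gmorph pres_group R -> H}) :
  (forall x, f (pgen x) = g (pgen x)) -> f =1 g.
Proof.
move=> fg; elim/pres_group_ind=> [|//|a b fga fgb|a fga].
- by rewrite !gmulf1.
- by rewrite !gmulfM fga fgb.
- by rewrite !gmulfV fga.
Qed.

Variable H : groupType.

Definition word_eval (f : X -> H) (w : word X) : H :=
  \prod_(a <- w) if a.2 then (f a.1)^-1 else f a.1.

Lemma word_eval_cat f u v : word_eval f (u ++ v) = word_eval f u * word_eval f v.
Proof. by rewrite /word_eval big_cat. Qed.

Lemma word_eval_nil f : word_eval f [::] = 1.
Proof. by rewrite /word_eval big_nil. Qed.

Lemma word_eval1 f x : word_eval f [:: (x, false)] = f x.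
Proof. by rewrite /word_eval big_seq1. Qed.

Definition respects (f : X -> H) :=
  forall u v, R u v -> word_eval f u = word_eval f v.

Variables (f : X -> H) (fR : respects f).

Lemma word_eval_pres u v : pres_eq R u v -> word_eval f u = word_eval f v.
Proof.
elim=> // {u v} [u v w _ -> _ ->|u u' v v' _ IHu _ IHv|x b] //.
  by rewrite !word_eval_cat IHu IHv.
rewrite -cat1s word_eval_cat word_eval_nil /word_eval !big_seq1 /=.
by case: b; rewrite /= ?mulgV ?mulVg.
Qed.

Definition pres_map of respects f :=
  fun a : pres_group R => word_eval f (repr a).

Lemma pres_map_pi w : pres_map fR (\pi_(pres_group R) w) = word_eval f w.
Proof. exact/word_eval_pres/pres_repr. Qed.

Fact pres_map_gmulfM : {morph pres_map fR : a b / a * b}.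
Proof.
elim/quotW=> u; elim/quotW=> v.
by rewrite -pi_cat !pres_map_pi word_eval_cat.
Qed.

Fact pres_map_gmulf1 : pres_map fR 1 = 1.
Proof. by rewrite -pi_nil pres_map_pi word_eval_nil. Qed.

HB.instance Definition _ :=
  isMultiplicative.Build _ _ (pres_map fR) pres_map_gmulfM.
HB.instance Definition _ :=
  Multiplicative_isUMagmaMorphism.Build _ _ (pres_map fR) pres_map_gmulf1.

Lemma pres_map_gen x : pres_map fR (pgen x) = f x.
Proof. by rewrite pres_map_pi word_eval1. Qed.

End PresentationTheory.

Section CrossedModule.

Local Open Scope group_scope.

Variable T : groupType.

Implicit Types (g h k : T) (x y : ext_square T).

Lemma lconjM g h k : lconj g (h * k) = lconj g h * lconj g k.
Proof. by rewrite /lconj !mulgA mulgVK. Qed.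

Lemma lconjA g h k : lconj (g * h) k = lconj g (lconj h k).
Proof. by rewrite /lconj invgM !mulgA. Qed.

Lemma lconj1 g : lconj 1 g = g.
Proof. by rewrite /lconj invg1 mulg1 mul1g. Qed.

Lemma lconjJ g h k : lconj (lconj g h) (lconj g k) = lconj g (lconj h k).
Proof. by rewrite -!lconjA; congr (lconj _ _); rewrite /lconj mulgVK. Qed.

Definition wedge g h : ext_square T := pgen (@ext_rel T) (g, h).

Lemma wedge_conjMl g g' h :
  wedge (g * g') h = wedge (lconj g g') (lconj g h) * wedge g h.
Proof. by have := pi_rel (ExtMull g g' h); rewrite pi_cat. Qed.

Lemma wedge_conjMr g h h' :
  wedge g (h * h') = wedge g h * wedge (lconj h g) (lconj h h').
Proof. by have := pi_rel (ExtMulr g h h'); rewrite pi_cat. Qed.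

Lemma wedgegg g : wedge g g = 1.
Proof. by have := pi_rel (ExtDiag g). Qed.

Lemma ext_square_ind (P : ext_square T -> Prop) :
    P 1 -> (forall g h, P (wedge g h)) ->
    (forall x y, P x -> P y -> P (x * y)) -> (forall x, P x -> P x^-1) ->
  forall x, P x.
Proof. by move=> P1 Pw PM PV; apply: pres_group_ind => // -[g h]; apply: Pw. Qed.

Lemma eq_ext_morph (H : groupType) (f f' : {gmorph ext_square T -> H}) :
  (forall g h, f (wedge g h) = f' (wedge g h)) -> f =1 f'.
Proof. by move=> ff'; apply: eq_pres_morph => -[g h]; apply: ff'. Qed.

Lemma ext_respects (H : groupType) (f : T * T -> H) :
    (forall g g' h, f (g * g', h) = f (lconj g g', lconj g h) * f (g, h)) ->
    (forall g h h', f (g, h * h') = f (g, h) * f (lconj h g, lconj h h')) ->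
    (forall g, f (g, g) = 1) ->
  respects (@ext_rel T) f.
Proof.
move=> fMl fMr fgg u v [g g' h|g h h'|g].
- by rewrite word_eval_cat !word_eval1.
- by rewrite word_eval_cat !word_eval1.
- by rewrite word_eval_nil word_eval1.
Qed.

Definition act_gen g (a : T * T) := wedge (lconj g a.1) (lconj g a.2).

Lemma act_respects g : respects (@ext_rel T) (act_gen g).
Proof.
apply: ext_respects => [h h' k|h k k'|h]; rewrite /act_gen /=.
- by rewrite lconjM wedge_conjMl !lconjJ.
- by rewrite lconjM wedge_conjMr !lconjJ.
- exact: wedgegg.
Qed.

Definition ext_act g := pres_map (act_respects g).

HB.instance Definition _ g := UMagmaMorphism.on (ext_act g).

Lemma ext_act_wedge g h k : ext_act g (wedge h k) = wedge (lconj g h) (lconj g k).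
Proof. exact: pres_map_gen. Qed.

Lemma ext_act_1 g : ext_act g 1 = 1. Proof. exact: gmulf1. Qed.

Lemma ext_act_M g x y : ext_act g (x * y) = ext_act g x * ext_act g y.
Proof. exact: gmulfM. Qed.

Lemma ext_act_V g x : ext_act g x^-1 = (ext_act g x)^-1.
Proof. exact: (gmulfV (ext_act g)). Qed.

Lemma ext_act1 x : ext_act 1 x = x.
Proof.
apply: (@eq_ext_morph _ (ext_act 1) idfun) => h k.
by rewrite /= ext_act_wedge !lconj1.
Qed.

Lemma ext_actM g h x : ext_act (g * h) x = ext_act g (ext_act h x).
Proof.
apply: (@eq_ext_morph _ (ext_act (g * h)) (ext_act g \o ext_act h)) => a b.
by rewrite /= !ext_act_wedge !lconjA.
Qed.

Lemma wedgeMl g g' h : wedge (g * g') h = ext_act g (wedge g' h) * wedge g h.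
Proof. by rewrite ext_act_wedge wedge_conjMl. Qed.

Lemma wedgeMr g h h' : wedge g (h * h') = wedge g h * ext_act h (wedge g h').
Proof. by rewrite ext_act_wedge wedge_conjMr. Qed.

Lemma wedge1g h : wedge 1 h = 1.
Proof.
by apply: (mulgI (wedge 1 h)); rewrite -{1}[wedge 1 h]ext_act1 -wedgeMl !mulg1.
Qed.

Lemma wedgeg1 g : wedge g 1 = 1.
Proof.
by apply: (mulgI (wedge g 1)); rewrite -{2}[wedge g 1]ext_act1 -wedgeMr !mulg1.
Qed.

Lemma bd_respects : respects (@ext_rel T) (fun a => lcomm a.1 a.2).
Proof.
apply: ext_respects => [g g' h|g h h'|g] /=.
- by rewrite /lcomm /lconj !invgM !invgK !mulgA !(mulgK, mulgVK).
- by rewrite /lcomm /lconj !invgM !invgK !mulgA !(mulgK, mulgVK).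
- exact/commute_lcomm1/commute_refl.
Qed.

Definition bd := pres_map bd_respects.

HB.instance Definition _ := UMagmaMorphism.on bd.

Lemma bd_wedge g h : bd (wedge g h) = lcomm g h.
Proof. exact: pres_map_gen. Qed.

Lemma bd1 : bd 1 = 1. Proof. exact: gmulf1. Qed.

Lemma bdM x y : bd (x * y) = bd x * bd y. Proof. exact: gmulfM. Qed.

Lemma bdV x : bd x^-1 = (bd x)^-1. Proof. exact: (gmulfV bd). Qed.

Lemma bd_act g x : bd (ext_act g x) = lconj g (bd x).
Proof.
elim/ext_square_ind: x => [|h k|x y IHx IHy|x IHx].
- by rewrite ext_act_1 bd1 /lconj mulg1 mulgV.
- rewrite ext_act_wedge !bd_wedge.
  by rewrite /lcomm /lconj !invgM !invgK !mulgA !(mulgK, mulgVK).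
- by rewrite ext_act_M !bdM lconjM IHx IHy.
- by rewrite ext_act_V !bdV IHx /lconj !invgM invgK mulgA.
Qed.

(** Expanding $gg' \wedge hh'$ first in the left and then in the right argument,
   or in the opposite order, gives the same product up to the two middle
   factors; their equality is the claim for $y$ an image of $g' \wedge h'$. *)
Lemma act_lcomm g h y :
  ext_act (lcomm g h) y = wedge g h * y * (wedge g h)^-1.
Proof.
have swap x : ext_act (g * h) x * wedge g h = wedge g h * ext_act (h * g) x.
  elim/ext_square_ind: x => [|g' h'|a b IHa IHb|a IHa].
  - by rewrite !ext_act_1 mulg1 mul1g.
  - apply: (mulgI (ext_act g (wedge g' h))).
    apply: (mulIg (ext_act h (wedge g h'))).
    transitivity (wedge (g * g') (h * h')).
      by rewrite wedgeMl !wedgeMr ext_act_M -ext_actM !mulgA.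
    by rewrite wedgeMr !wedgeMl ext_act_M -ext_actM !mulgA.
  - by rewrite !ext_act_M -mulgA IHb mulgA IHa mulgA.
  - apply: (mulgI (ext_act (g * h) a)); rewrite !ext_act_V mulgA mulgV mul1g.
    by rewrite mulgA IHa mulgK.
apply: (canRL (mulgK _)).
rewrite -[y in RHS]ext_act1 -(mulgV (h * g)) ext_actM -swap.
by rewrite -ext_actM; congr (ext_act _ _ * _); rewrite /lcomm invgM !mulgA.
Qed.

Lemma act_bd x y : ext_act (bd x) y = x * y * x^-1.
Proof.
elim/ext_square_ind: x y => [|g h|a b IHa IHb|a IHa] y.
- by rewrite bd1 ext_act1 mul1g invg1 mulg1.
- by rewrite bd_wedge act_lcomm.
- by rewrite bdM ext_actM IHb IHa invgM !mulgA.
- rewrite bdV invgK -[RHS]ext_act1 -(mulVg (bd a)) ext_actM IHa.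
  by rewrite !mulgA mulgV mul1g mulgK.
Qed.

(** Expand $g \wedge (h k h^(-1)) k^(-1)$ and compare with
   $gh \wedge k = h (h^(-1) g h) \wedge k$. *)
Lemma wedge_lcomm g h k :
  wedge g (lcomm h k) = ext_act g (wedge h k) * (wedge h k)^-1.
Proof.
have wV : wedge g k^-1 = (ext_act k^-1 (wedge g k))^-1.
  by apply: divg1_eq; rewrite invgK -wedgeMr mulVg wedgeg1.
have -> : lcomm h k = lconj h k * k^-1 by [].
rewrite wedgeMr wV ext_act_V -ext_actM -[lconj h k * k^-1]/(lcomm h k) act_lcomm.
rewrite !invgM invgK !mulgA; congr (_ * _); apply: (canLR (mulgK _)).
have gh : g * h = h * (h^-1 * g * h) by rewrite !mulgA mulgV mul1g.
rewrite -wedgeMl gh wedge_conjMl; congr (wedge _ _ * _).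
by rewrite /lconj !mulgA mulgV mul1g mulgK.
Qed.

(** This makes the kernel of the boundary fixed by $T$, as [act_bd] makes it
   central. *)
Lemma wedge_bd g x : wedge g (bd x) = ext_act g x * x^-1.
Proof.
elim/ext_square_ind: x => [|h k|x y IHx IHy|x IHx].
- by rewrite bd1 ext_act_1 wedgeg1 invg1 mulg1.
- by rewrite bd_wedge wedge_lcomm.
- by rewrite bdM ext_act_M wedgeMr IHx IHy act_bd invgM !mulgA !mulgVK.
- have := wedgeMr g (bd x) (bd x)^-1.
  rewrite mulgV wedgeg1 IHx act_bd !mulgA mulgVK bdV => E.
  apply: (mulgI (ext_act g x)); apply: (mulIg x^-1).
  by rewrite -E ext_act_V invgK mulgA mulgV mul1g mulgV.
Qed.

End CrossedModule.

(** * The exponent of the exterior square *)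

Section ExponentExteriorSquare.

Variables (p q : nat) (T : finGroupType).

Local Notation D := ([set: T]^`(1))%G.

Hypotheses (p_prime : prime p) (p_odd : odd p) (q_pnat : p.-nat q).
Hypothesis expT : forall x : T, (x ^+ q = 1)%g.
Hypothesis abD : abelian D.
Hypothesis lcnT : 'L_(2 * p)([set: T])%g = 1%g.

Let r := uphalf q.

Let q_double : (r + r)%N = q.+1.
Proof.
have q_odd : odd q by have/p_natP[n ->] := q_pnat; rewrite oddX p_odd orbT.
rewrite addnn /r uphalf_half q_odd doubleD.
by rewrite -[in RHS](odd_double_half q) q_odd; lia.
Qed.

Local Open Scope group_scope.

Let lcomm_in (x y : T) : lcomm x y \in D.
Proof.
have -> : lcomm x y = [~ x^-1, y^-1] by rewrite commgEl conjgE !invgK /lcomm !mulgA.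
by rewrite mem_commg ?inE.
Qed.

Let lconj_in (x a : T) : a \in D -> lconj x a \in D.
Proof.
have -> : lconj x a = conjg a x^-1 by rewrite /lconj conjgE invgK mulgA.
by rewrite memJ_norm // (subsetP (normal_norm (der_normal 1 _))) ?inE.
Qed.

Lemma derived_baer : baer_cond (subg_of D) r.
Proof.
have com (x y : subg_of D) : lcomm x y = 1.
  apply: commute_lcomm1; apply: val_inj; rewrite /= /commute.
  exact: (centsP abD) (subgP x) _ (subgP y).
by split=> x y => [z|]; rewrite com ?expg1n //; apply/commute_sym/commute1.
Qed.

Let A : zmodType := baer derived_baer.

Let inA (a : T) : A := to_baer derived_baer (subg D a).
Let outA (a : A) : T := sgval (@of_baer _ _ derived_baer a).

Let inAK a : a \in D -> outA (inA a) = a.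
Proof. exact: subgK. Qed.

Let outAK : cancel outA inA.
Proof. by move=> a; apply: val_inj; rewrite /= subgK // subgP. Qed.

Let outA_in a : outA a \in D.
Proof. exact: subgP. Qed.

Let outAD a b : outA (a + b)%R = outA a * outA b.
Proof.
rewrite -(@of_baerK _ _ derived_baer a) -(@of_baerK _ _ derived_baer b).
rewrite -to_baerM_commute //; apply: val_inj; rewrite /= /commute.
exact: (centsP abD) (subgP _) _ (subgP _).
Qed.

Let outAN a : outA (- a)%R = (outA a)^-1. Proof. by []. Qed.

Let outA0 : outA 0%R = 1. Proof. by []. Qed.

Definition conj_sub x (a : subg_of D) : subg_of D := subg D (lconj x (sgval a)).

Fact conj_sub_gmulfM x : {morph conj_sub x : a b / a * b}.
Proof.
by move=> a b; rewrite /conj_sub lconjM subgM //; apply/lconj_in/subgP.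
Qed.

Fact conj_sub_gmulf1 x : conj_sub x 1 = 1.
Proof.
rewrite /conj_sub -[sgval 1]/(1 : T) /lconj mulg1 mulgV.
by apply: val_inj; rewrite /= subgK ?group1.
Qed.

HB.instance Definition _ x :=
  isMultiplicative.Build _ _ (conj_sub x) (conj_sub_gmulfM x).
HB.instance Definition _ x :=
  Multiplicative_isUMagmaMorphism.Build _ _ (conj_sub x) (conj_sub_gmulf1 x).

Let act (x : T) : {additive A -> A} :=
  @baer_map _ _ _ derived_baer derived_baer (conj_sub x).

Let outA_act x a : outA (act x a) = lconj x (outA a).
Proof. by rewrite /outA /= subgK // lconj_in // subgP. Qed.

Let comm (y x : T) : A := inA (lcomm y x).

Let outA_comm y x : outA (comm y x) = lcomm y x.
Proof. exact: inAK. Qed.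

Let act1 a : act 1 a = a.
Proof. by apply: (can_inj outAK); rewrite outA_act lconj1. Qed.

Let actM x y a : act (x * y) a = act x (act y a).
Proof. by apply: (can_inj outAK); rewrite !outA_act lconjA. Qed.

Let actC x y a : act x (act y a) = act y (act x a).
Proof.
apply: (can_inj outAK); rewrite !outA_act -!lconjA -(lcommK x y) -mulgA.
rewrite [LHS]lconjA [LHS]/lconj; apply: (canLR (mulgK _)).
by apply: (centsP abD) => //; apply: lconj_in.
Qed.

Let commMr y x x' : comm y (x * x') = (comm y x + act x (comm y x'))%R.
Proof.
apply: (can_inj outAK); rewrite outAD outA_act !outA_comm.
by rewrite /lcomm /lconj invgM !mulgA !mulgVK.
Qed.

Let commMl y y' x : comm (y * y') x = (act y (comm y' x) + comm y x)%R.
Proof.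
apply: (can_inj outAK); rewrite outAD outA_act !outA_comm.
by rewrite /lcomm /lconj invgM !mulgA !mulgVK.
Qed.

Let commV y x : comm x y = (- comm y x)%R.
Proof.
apply/eqP; rewrite -addr_eq0; apply/eqP/(can_inj outAK).
by rewrite outAD !outA_comm -(lcommV y x) mulVg.
Qed.

Let Fil k (a : A) := outA a \in 'L_k.+2([set: T]).

Let FilT a : Fil 0 a.
Proof. by rewrite /Fil lcn2 outA_in. Qed.

Let FilD k a b : Fil k a -> Fil k b -> Fil k (a + b)%R.
Proof. by rewrite /Fil outAD; apply: groupM. Qed.

Let FilS k x a : Fil k a -> Fil k.+1 (delta (act x) a).
Proof.
rewrite /Fil => aL; suff -> : outA (delta (act x) a) = [~ x^-1, (outA a)^-1].
  by rewrite lcnSn commGC mem_commg ?inE ?groupV.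
by rewrite outAD outA_act outAN commgEl conjgE !invgK /lconj !mulgA.
Qed.

Let Fil_trivial k a : (2 * p - 2 <= k)%N -> Fil k a -> a = 0%R.
Proof.
move=> pk; rewrite /Fil => aL; apply: (can_inj outAK); rewrite outA0.
suff: outA a \in 'L_(2 * p)([set: T]) by rewrite lcnT => /set1P.
by apply: subsetP aL; apply: lcn_sub_leq; have := prime_gt1 p_prime; lia.
Qed.

Let expA (a : A) : (a *+ q)%R = 0%R.
Proof.
have outAX n : outA (a *+ n)%R = outA a ^+ n.
  by elim: n => // n IHn; rewrite mulrS outAD IHn expgS.
by apply: (can_inj outAK); rewrite outAX expT outA0.
Qed.

Let outA_norm n x a :
  (outA a * x) ^+ n = outA (iter_sum (act x) n a) * x ^+ n.
Proof.
elim: n => [|n IHn]; first by rewrite iter_sum0 outA0 mulg1.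
rewrite iter_sumSl outAD outA_act /lconj !expgS IHn !mulgA.
by rewrite !mulgVK.
Qed.

Let norm_q x a : iter_sum (act x) q a = 0%R.
Proof.
by apply: (can_inj outAK); have := outA_norm q x a; rewrite !expT mulg1 outA0.
Qed.

Let comm_expl y x n : comm (y ^+ n) x = iter_sum (act y) n (comm y x).
Proof.
elim: n => [|n IHn]; last by rewrite expgS commMl IHn iter_sumSl addrC.
rewrite iter_sum0; apply: (can_inj outAK); rewrite outA_comm.
by rewrite commute_lcomm1 //; apply/commute_sym/commute1.
Qed.

Let outA_power n x y : (x * y) ^+ n =
  outA (\sum_(i < n) act (x ^+ i) (iter_sum (act y) i (comm y x)))%R *
  x ^+ n * y ^+ n.
Proof.
elim: n => [|n IHn]; first by rewrite big_ord0 outA0 !mulg1.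
rewrite big_ord_recr outAD outA_act -comm_expl outA_comm expgSr IHn.
rewrite /lconj !expgSr -!mulgA; congr (_ * (_ * _)).
by rewrite mulKg /lcomm !mulgA !mulgVK.
Qed.

Let power_q x y :
  (\sum_(i < q) act (x ^+ i) (iter_sum (act y) i (comm y x)))%R = 0%R.
Proof.
by apply: (can_inj outAK); have := outA_power q x y; rewrite !expT !mulg1 outA0.
Qed.

Let engel_A x y : (iter_sum2 (act x) p (comm y x) *+ 'C(q, p))%R = 0%R.
Proof. exact: (@engel_p p q T A act comm Fil). Qed.

Let iter_delta_A n x a :
  (2 * p - 2 <= n)%N -> iter n (delta (act x)) a = 0%R.
Proof. exact: (@iter_delta_act_eq0 p T A act Fil). Qed.

Implicit Types w : ext_square T.

Let bd_in w : bd w \in D.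
Proof.
elim/ext_square_ind: w => [|g h|x y xD yD|x xD].
- by rewrite bd1 group1.
- by rewrite bd_wedge lcomm_in.
- by rewrite bdM groupM.
- by rewrite bdV groupV.
Qed.

Let bd_eq1_central w z : bd w = 1 -> commute w z.
Proof.
move=> w1; apply: (mulIg w^-1); rewrite mulgK.
by rewrite -act_bd w1 ext_act1.
Qed.

Let bd_eq1_act g w : bd w = 1 -> ext_act g w = w.
Proof.
by move=> w1; apply: divg1_eq; rewrite -wedge_bd w1 wedgeg1.
Qed.

Let bd_lcomm w w' : bd (lcomm w w') = 1.
Proof.
rewrite (lcomm_morph (@bd T)); apply: commute_lcomm1.
exact: (centsP abD) (bd_in w) _ (bd_in w').
Qed.

Let lcomm_central w1 w2 w3 : commute (lcomm w1 w2) w3.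
Proof. exact: bd_eq1_central. Qed.

Let lcomm_q w w' : lcomm w w' ^+ q = 1.
Proof.
rewrite -(lcommXl lcomm_central) commute_lcomm1 //.
by apply: bd_eq1_central; rewrite (gmulfXn (@bd T)) expT.
Qed.

Lemma ext_square_baer : baer_cond (ext_square T) r.
Proof. by split=> // w w'; rewrite q_double expgS lcomm_q mulg1. Qed.

Let V : zmodType := baer ext_square_baer.

Local Notation inV := (to_baer ext_square_baer).
Local Notation outV := (@of_baer _ _ ext_square_baer).

Definition bd_sub w : subg_of D := subg D (bd w).

Fact bd_sub_gmulfM : {morph bd_sub : x y / x * y}.
Proof. by move=> x y; rewrite /bd_sub bdM subgM. Qed.

Fact bd_sub_gmulf1 : bd_sub 1 = 1.
Proof. by apply: val_inj; rewrite /bd_sub bd1 /= subgK ?group1. Qed.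

HB.instance Definition _ := isMultiplicative.Build _ _ bd_sub bd_sub_gmulfM.
HB.instance Definition _ :=
  Multiplicative_isUMagmaMorphism.Build _ _ bd_sub bd_sub_gmulf1.

Let d : {additive V -> A} := @baer_map _ _ _ ext_square_baer derived_baer bd_sub.
Let phi g : {additive V -> V} :=
  @baer_map _ _ _ ext_square_baer ext_square_baer (ext_act g).

Let outA_d v : outA (d v) = bd (outV v).
Proof. by rewrite /outA /= subgK. Qed.

Let d_phi g v : d (phi g v) = act g (d v).
Proof. by apply: (can_inj outAK); rewrite outA_act !outA_d bd_act. Qed.

Let d_wedge g h : d (inV (wedge g h)) = comm g h.
Proof. by apply: (can_inj outAK); rewrite outA_d outA_comm bd_wedge. Qed.

Let d_eq0 v : d v = 0%R -> bd (outV v) = 1.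
Proof. by move=> v0; rewrite -outA_d v0. Qed.

Let phi_fix g v : d v = 0%R -> delta (phi g) v = 0%R.
Proof.
move=> /d_eq0 v1; apply/eqP; rewrite subr_eq0; apply/eqP.
exact: bd_eq1_act.
Qed.

Let d_bracket u v : d (bracket u v) = 0%R.
Proof. by apply: (can_inj outAK); rewrite outA_d bd_lcomm. Qed.

Let phi_fixE g v : d v = 0%R -> phi g v = v.
Proof. by move/(phi_fix g)/eqP; rewrite subr_eq0 => /eqP. Qed.

Let bracket_d0 u v : d u = 0%R -> bracket u v = 0%R.
Proof.
move=> /d_eq0 u1; rewrite /bracket commute_lcomm1 //.
exact: bd_eq1_central.
Qed.

Let bracket_q (u v : V) : (bracket u v *+ r *+ q)%R = 0%R.
Proof.
have b0 : (bracket u v *+ q)%R = 0%R by rewrite /bracket -to_baerX lcomm_q.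
by rewrite mulrnAC b0 mul0rn.
Qed.

(** With $c = g \wedge h$ and $c_i$ its image under $g^i$, the left side is the
   product $c_(n-1) ... c_1 c_0$. In the Lie ring it is the sum of the $c_i$
   plus half of the sum over $j < i$ of the brackets of $c_i$ and $c_j$, and
   these depend on $i - j$ only since $g$ fixes every bracket. *)
Let wedge_expl g h n : let c := inV (wedge g h) in
  inV (wedge (g ^+ n) h) =
  (iter_sum (phi g) n c + bracket (phi g (iter_sum2 (phi g) n c)) c *+ r)%R.
Proof.
move=> c; elim: n => [|n IHn].
  rewrite expg0 wedge1g iter_sum0 /iter_sum2 big_ord0 raddf0 bracket0l mul0rn.
  by rewrite addr0.
rewrite expgS wedgeMl to_baerM -/c.
have -> : inV (ext_act g (wedge (g ^+ n) h)) =
    (phi g (iter_sum (phi g) n c) +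
     bracket (phi g (iter_sum2 (phi g) n c)) c *+ r)%R.
  transitivity (phi g (inV (wedge (g ^+ n) h))) => //.
  rewrite IHn (raddfD (phi g)); congr (_ + _)%R.
  by rewrite phi_fixE // (raddfMn d) d_bracket mul0rn.
rewrite bracketDl bracket_lcomm0 addr0 iter_sumSl iter_sum2S raddfD bracketDl.
by rewrite mulrnDl [(c + _)%R]addrC addrACA !addrA.
Qed.

Let qpower_morph w w' : w ^+ q = 1 -> (w * w') ^+ q = w' ^+ q.
Proof.
move=> w1; apply: (can_inj (@to_baerK _ _ ext_square_baer)).
rewrite to_baerX to_baerM !mulrnDl bracket_q addr0 -!to_baerX w1.
by rewrite to_baer1 add0r.
Qed.

(** The relation $g^q \wedge h = 1$, evaluated in the Lie ring. Its bracket part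
   is zero because the other entry of the bracket lies in the kernel of the
   boundary, by [engel_A]. The rest is $q c$ plus a sum over the orbit of
   $c' = g c - c$; the hypothesis gives $q c' = 0$, so that the sum reduces to
   a multiple of $C(q, p)$, which again vanishes by [engel_A]. *)
Let wedge_q_step (g h : T) :
  (forall g' : T, wedge g' (lcomm g h) ^+ q = 1) -> wedge g h ^+ q = 1.
Proof.
set w := wedge g h => wedge_q.
pose c := inV w; pose c' := delta (phi g) c.
have p_gt1 := prime_gt1 p_prime.
have engel_V : d (iter_sum2 (phi g) p c *+ 'C(q, p))%R = 0%R.
  rewrite raddfMn (intertwine_iter_sum2 (d_phi g)) d_wedge commV raddfN mulNrn.
  by rewrite engel_A oppr0.
have dS : d (phi g (iter_sum2 (phi g) q c)) = 0%R.
  rewrite d_phi (intertwine_iter_sum2 (d_phi g)) d_wedge.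
  rewrite (iter_sum2_reduce p_prime q_pnat) ?expA ?iter_delta_A //.
  by rewrite commV raddfN mulNrn engel_A oppr0 raddf0.
have sum0 : iter_sum (phi g) q c = 0%R.
  have : inV (wedge (g ^+ q) h) = (iter_sum (phi g) q c +
    bracket (phi g (iter_sum2 (phi g) q c)) c *+ r)%R := wedge_expl g h q.
  by rewrite (bracket_d0 _ dS) mul0rn addr0 expT wedge1g to_baer1 => <-.
have c'q : (c' *+ q = 0)%R.
  rewrite /c' /delta mulrnBl; apply/eqP; rewrite subr_eq0; apply/eqP.
  transitivity (inV (ext_act g w ^+ q)); first by rewrite to_baerX.
  transitivity (inV (w ^+ q)); last by rewrite to_baerX.
  congr (inV _).
  rewrite -[ext_act g w](mulgVK w) -wedge_bd qpower_morph // bd_wedge.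
  exact: wedge_q.
have dc' n : (2 * p - 2 <= n)%N -> iter n (delta (phi g)) c' = 0%R.
  move=> pn; rewrite /c' -iterSr iterS; apply: phi_fix.
  rewrite (intertwine_iter (intertwine_delta (d_phi g))).
  exact: iter_delta_A.
have commS : delta (phi g) (iter_sum2 (phi g) p c) = iter_sum2 (phi g) p c'.
  by apply: (intertwine_iter_sum2 (F := delta (phi g))) => v; rewrite /delta raddfB.
have S0 : (iter_sum2 (phi g) p c' *+ 'C(q, p) = 0)%R.
  rewrite -commS; apply: etrans (phi_fix g engel_V).
  by rewrite (raddfMn (delta (phi g))).
have := iter_sum_iter_sum2 (phi g) q c; rewrite sum0 -/c'.
rewrite (iter_sum2_reduce p_prime q_pnat) ?dc' // S0 addr0 => /esym.
by rewrite /c -to_baerX => /(congr1 outV).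
Qed.

(** Descending induction on the term of the lower central series that contains
   $h$. *)
Let wedge_q (g h : T) : wedge g h ^+ q = 1.
Proof.
have step m k (g' h' : T) : (2 * p - 1 <= k + m)%N ->
    h' \in 'L_k.+1([set: T]) -> wedge g' h' ^+ q = 1.
  elim: m k g' h' => [|m IHm] k g' h' le_pk hL.
    have : h' \in 'L_(2 * p)([set: T]).
      by apply: subsetP hL; apply: lcn_sub_leq; move: le_pk; lia.
    by rewrite lcnT => /set1P->; rewrite wedgeg1 expg1n.
  apply: wedge_q_step => x; apply: (IHm k.+1); first by move: le_pk; lia.
  have -> : lcomm g' h' = [~ g'^-1, h'^-1].
    by rewrite commgEl conjgE !invgK /lcomm !mulgA.
  by rewrite lcnSn commGC mem_commg ?inE ?groupV.
by apply: (step (2 * p - 1) 0 g h)%N; rewrite ?lcn1 ?inE ?add0n.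
Qed.

Theorem ext_square_expq w : w ^+ q = 1.
Proof.
elim/ext_square_ind: w => [|g h|x y xq yq|x xq].
- exact: expg1n.
- exact: wedge_q.
- by rewrite qpower_morph.
- by rewrite expVgn xq invg1.
Qed.

End ExponentExteriorSquare.

(** * Central extensions and abelianization *)

Section Abelianization.

Local Open Scope group_scope.

(** A predicate and not a finite set, as the groups of this part are infinite. *)
Record derived_subgroup (H : groupType) (S : H -> Prop) : Prop := {
  der_sub1 : S 1;
  der_subM : forall x y, S x -> S y -> S (x * y);
  der_subV : forall x, S x -> S x^-1;
  der_sub_lcomm : forall x y, S (lcomm x y) }.

Variables (H : groupType) (S : H -> Prop) (hS : derived_subgroup S).

Lemma der_subJ x y : S x -> S (y * x * y^-1).
Proof.
move=> Sx; rewrite -[y * x * y^-1](mulgVK x).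
by apply: der_subM => //; apply: der_sub_lcomm.
Qed.

Definition coset_eqb of derived_subgroup S : rel H :=
  fun x y => `[< S (x * y^-1) >].

Lemma coset_eqb_equiv : equiv_class_of (coset_eqb hS).
Proof.
split=> [x|x y|y x z].
- by apply/asboolP; rewrite mulgV; apply: der_sub1.
- by apply/asboolP/asboolP => /(der_subV hS); rewrite invgM invgK.
- move=> /asboolP xy /asboolP yz; apply/asboolP.
  by have := der_subM hS xy yz; rewrite mulgA mulgVK.
Qed.

Canonical coset_eqb_equiv_rel := EquivRelPack coset_eqb_equiv.

Definition abel := {eq_quot (coset_eqb hS)}.

HB.instance Definition _ := Choice.on abel.
HB.instance Definition _ := EqQuotient.on abel.

Definition abel_pi (x : H) : abel := \pi_abel x.

Lemma abel_piP x y : abel_pi x = abel_pi y <-> S (x * y^-1).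
Proof.
split=> [/eqP|Sxy]; first by rewrite eqmodE => /asboolP.
by apply/eqP; rewrite eqmodE; apply/asboolP.
Qed.

Definition abel_add (a b : abel) : abel := abel_pi (repr a * repr b).
Definition abel_opp (a : abel) : abel := abel_pi (repr a)^-1.

Lemma abel_piK a : abel_pi (repr a) = a. Proof. exact: reprK. Qed.

Lemma abel_repr x : S (repr (abel_pi x) * x^-1).
Proof. by apply/abel_piP; rewrite abel_piK. Qed.

Lemma abel_piM x y : abel_pi (x * y) = abel_add (abel_pi x) (abel_pi y).
Proof.
apply/esym/abel_piP; set x' := repr _; set y' := repr _.
have Sx : S (x' * x^-1) by apply: abel_repr.
have /(der_subJ x) Sy : S (y' * y^-1) by apply: abel_repr.
by have := der_subM hS Sx Sy; rewrite invgM !mulgA !mulgVK.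
Qed.

Lemma abel_piV x : abel_pi x^-1 = abel_opp (abel_pi x).
Proof.
apply/abel_piP; have := der_subJ x^-1 (abel_repr x).
by rewrite !invgK !mulgA mulgVK.
Qed.

Lemma abel_addA : associative abel_add.
Proof.
by move=> a b c; rewrite -[a]abel_piK -[b]abel_piK -[c]abel_piK -!abel_piM mulgA.
Qed.

Lemma abel_addC : commutative abel_add.
Proof.
move=> a b; rewrite -[a]abel_piK -[b]abel_piK -!abel_piM.
by apply/abel_piP; rewrite invgM mulgA; apply: der_sub_lcomm.
Qed.

Lemma abel_add0 : left_id (abel_pi 1) abel_add.
Proof. by move=> a; rewrite -[a]abel_piK -abel_piM mul1g. Qed.

Lemma abel_addN : left_inverse (abel_pi 1) abel_opp abel_add.
Proof. by move=> a; rewrite -[a]abel_piK -abel_piV -abel_piM mulVg. Qed.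

HB.instance Definition _ := GRing.isZmodule.Build abel
  abel_addA abel_addC abel_add0 abel_addN.

Lemma abel_piD x y : abel_pi (x * y) = (abel_pi x + abel_pi y)%R.
Proof. exact: abel_piM. Qed.

Lemma abel_pi_eq0 x : abel_pi x = 0%R <-> S x.
Proof. by rewrite -[0%R]/(abel_pi 1) abel_piP invg1 mulg1. Qed.

End Abelianization.

Lemma lcomm_mul_central (H : groupType) (z x y : H) :
  (forall u, commute z u) -> lcomm (z * x)%g y = lcomm x y.
Proof.
move=> zC; rewrite /lcomm invgM -[(z * x * y)%g]mulgA zC !mulgA.
by rewrite -[(_ * z * x^-1)%g]mulgA zC !mulgA mulgK.
Qed.

Section CentralExtension.

Variables (T : groupType) (B : zmodType) (f : T -> T -> B).

Local Open Scope ring_scope.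

Definition cocycle := forall g h k : T,
  f h k + f g (h * k)%g = f (g * h)%g k + f g h.

(** The cocycle need not be normalized: the identity is $(- f(1, 1), 1)$. *)
Definition cext of cocycle : Type := (B * T)%type.

Variable fZ : cocycle.

Lemma cocycle1r g : f g 1%g = f 1%g 1%g.
Proof. by have := fZ g 1%g 1%g; rewrite !mulg1 => /addIr/esym. Qed.

Lemma cocycle1l g : f 1%g g = f 1%g 1%g.
Proof. by have := fZ 1%g 1%g g; rewrite !mul1g => /addrI. Qed.

Lemma cocycleV g : f g g^-1%g = f g^-1%g g.
Proof.
have := fZ g g^-1%g g; rewrite mulVg mulgV cocycle1r cocycle1l.
by rewrite [RHS]addrC => /addIr/esym.
Qed.

HB.instance Definition _ := Choice.copy (cext fZ) (B * T)%type.

Definition cext_mul (x y : cext fZ) : cext fZ :=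
  (x.1 + y.1 + f x.2 y.2, (x.2 * y.2)%g).
Definition cext_one : cext fZ := (- f 1%g 1%g, 1%g).
Definition cext_inv (x : cext fZ) : cext fZ :=
  (- (x.1 + f x.2^-1%g x.2 + f 1%g 1%g), x.2^-1%g).

Lemma cext_mulA : associative cext_mul.
Proof.
move=> [a g] [b h] [c k]; rewrite /cext_mul /= mulgA; congr (_, _).
rewrite -!addrA; congr (_ + (_ + _)).
by rewrite fZ addrC [RHS]addrC addrC addrA.
Qed.

Lemma cext_mul1 : left_id cext_one cext_mul.
Proof.
move=> [b h]; rewrite /cext_mul /= mul1g cocycle1l; congr (_, _).
by rewrite addrAC addNr add0r.
Qed.

Lemma cext_mulr1 : right_id cext_one cext_mul.
Proof.
by move=> [b h]; rewrite /cext_mul /= mulg1 cocycle1r subrK.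
Qed.

Lemma cext_mulV : left_inverse cext_one cext_inv cext_mul.
Proof.
move=> [a g]; rewrite /cext_mul /cext_inv /= mulVg; congr (_, _).
by rewrite -addrA opprD addrC addNKr.
Qed.

Lemma cext_mulVr : right_inverse cext_one cext_inv cext_mul.
Proof.
move=> [a g]; rewrite /cext_mul /cext_inv /= mulgV cocycleV; congr (_, _).
by rewrite addrAC opprD addNKr.
Qed.

HB.instance Definition _ := isGroup.Build (cext fZ)
  cext_mulA cext_mul1 cext_mulr1 cext_mulV cext_mulVr.

Local Open Scope group_scope.

Lemma cextM (x y : cext fZ) : x * y = ((x.1 + y.1 + f x.2 y.2)%R, x.2 * y.2).
Proof. by []. Qed.

Lemma cext1 : 1 = ((- f 1 1)%R, 1) :> cext fZ.
Proof. by []. Qed.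

Lemma cext_projM (x y : cext fZ) : (x * y).2 = x.2 * y.2.
Proof. by []. Qed.

Lemma cext_projV (x : cext fZ) : (x^-1).2 = x.2^-1.
Proof. by []. Qed.

Lemma cext_central (x y : cext fZ) : x.2 = 1 -> commute x y.
Proof.
case: x y => [a g] [b h] /= ->; rewrite /commute !cextM /= mul1g mulg1.
by rewrite cocycle1l cocycle1r [(a + b)%R]addrC.
Qed.

Lemma cext_lcomm_proj (x x' y y' : cext fZ) :
  x.2 = x'.2 -> y.2 = y'.2 -> lcomm x y = lcomm x' y'.
Proof.
have aux (x1 x2 y1 : cext fZ) : x1.2 = x2.2 -> lcomm x1 y1 = lcomm x2 y1.
  move=> x12; rewrite -[x1](mulgVK x2) lcomm_mul_central // => u.
  by apply: cext_central; rewrite cext_projM cext_projV x12 mulgV.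
move=> xx' yy'; rewrite (aux _ _ _ xx').
by apply: invg_inj; rewrite !lcommV (aux _ _ _ yy').
Qed.

Definition clift (g : T) : cext fZ := (0%R, g).

Lemma wedge_cext_respects :
  respects (@ext_rel T) (fun a => lcomm (clift a.1) (clift a.2)).
Proof.
apply: ext_respects => [g g' h|g h h'|g] /=.
- rewrite (@cext_lcomm_proj _ (clift g * clift g') _ (clift h)) //.
  rewrite (@cext_lcomm_proj (clift (lconj g g')) (lconj (clift g) (clift g'))
           (clift (lconj g h)) (lconj (clift g) (clift h))) //.
  by rewrite /lcomm /lconj !invgM !invgK !mulgA !(mulgK, mulgVK).
- rewrite (@cext_lcomm_proj _ (clift g) _ (clift h * clift h')) //.
  rewrite (@cext_lcomm_proj (clift (lconj h g)) (lconj (clift h) (clift g))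
           (clift (lconj h h')) (lconj (clift h) (clift h'))) //.
  by rewrite /lcomm /lconj !invgM !invgK !mulgA !(mulgK, mulgVK).
- exact/commute_lcomm1/commute_refl.
Qed.

(** Commutators in a central extension of $T$ depend only on the images of their
   entries in $T$, so that they define a morphism on the exterior square. *)
Definition wedge_cext := pres_map wedge_cext_respects.

HB.instance Definition _ := UMagmaMorphism.on wedge_cext.

Lemma wedge_cext_derived :
  derived_subgroup (fun x => exists w, wedge_cext w = x).
Proof.
split.
- by exists 1; apply: gmulf1.
- by move=> _ _ [v <-] [w <-]; exists (v * w); apply: gmulfM.
- by move=> _ [v <-]; exists v^-1; apply: (gmulfV wedge_cext).
- move=> x y; exists (wedge x.2 y.2); rewrite [LHS]pres_map_gen.
  exact: cext_lcomm_proj.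
Qed.

End CentralExtension.

(** * The exponent of the second homology group *)

Section SchurMultiplier.

Variable T : finGroupType.

Local Open Scope ring_scope.

Local Notation freeZ I := {ffun I -> int}.

Definition boundary3 : pred (freeZ (T * T)) :=
  fun z => `[< exists b, bar_d3 b = z >].

Lemma boundary3_zmod_closed : zmod_closed boundary3.
Proof.
split=> [|z z' /asboolP[b db] /asboolP[b' db']]; apply/asboolP.
  by exists 0; rewrite raddf0.
by exists (b - b'); rewrite raddfB /= db db'.
Qed.

HB.instance Definition _ :=
  GRing.isZmodClosed.Build _ boundary3 boundary3_zmod_closed.

(** The target of the universal 2-cocycle of $T$, which contains the second
   homology group as the kernel of [bar_d2]. *)
Definition coker3 : zmodType :=
  Quotient.quot (GRing.ZmodClosed.clone (freeZ (T * T)) boundary3 _).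

Definition coker3_pi (z : freeZ (T * T)) : coker3 := \pi z.

Fact coker3_pi_is_zmod_morphism : zmod_morphism coker3_pi.
Proof. by move=> z z'; rewrite /coker3_pi raddfB. Qed.

HB.instance Definition _ :=
  GRing.isZmodMorphism.Build _ _ coker3_pi coker3_pi_is_zmod_morphism.

Lemma coker3_pi_eq0 z : coker3_pi z = 0 <-> exists b, bar_d3 b = z.
Proof.
have -> : (exists b, bar_d3 b = z) <-> z \in boundary3.
  by split=> [?|/asboolP//]; apply/asboolP.
have -> : (z \in boundary3) = (coker3_pi z == coker3_pi 0).
  by rewrite -[z in LHS]subr0 Quotient.idealrBE.
by rewrite raddf0; split=> [->|/eqP].
Qed.

Definition univ_cocycle (g h : T) : coker3 := coker3_pi (basisZ (g, h)).

Lemma univ_cocycleP : cocycle univ_cocycle.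
Proof.
move=> g h k; apply/eqP; rewrite -subr_eq0 /univ_cocycle -!raddfD -raddfB.
apply/eqP/coker3_pi_eq0; exists (basisZ (g, h, k)).
rewrite /bar_d3 extendZ_basis.
by rewrite opprD addrA; congr (_ - _); rewrite addrAC.
Qed.

Lemma ffunMzE (I : finType) (z : freeZ I) m i : (z *~ m) i = z i *~ m.
Proof. by case: m => n; rewrite ?NegzE ?mulrNz ?ffunE -!pmulrn ?ffunMnE. Qed.

HB.instance Definition _ (I : finType) (V : zmodType) (f : I -> V) :=
  GRing.isZmodMorphism.Build _ _ (extendZ f) (extendZ_is_zmod_morphism f).

Lemma eq_extendZ (I : finType) (V : zmodType) (F : {additive freeZ I -> V}) z :
  F z = extendZ (fun i => F (basisZ i)) z.
Proof.
have {1}-> : z = \sum_i basisZ i *~ z i.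
  apply/ffunP => j; rewrite sum_ffunE (bigD1 j) //=.
  have E i : (basisZ i *~ z i) j = (j == i)%:R * z i.
    by rewrite ffunMzE ffunE -mulrzr intz.
  rewrite E eqxx mul1r big1 ?addr0 // => i ij.
  by rewrite E eq_sym (negPf ij) mul0r.
by rewrite raddf_sum; apply: eq_bigr => i _; rewrite raddfMz.
Qed.

Let E := cext univ_cocycleP.
Let S := wedge_cext_derived univ_cocycleP.

Definition coker3_in (z : freeZ (T * T)) : E :=
  (coker3_pi z - univ_cocycle 1%g 1%g, 1%g).

Lemma coker3_inD z z' : coker3_in (z + z') = (coker3_in z * coker3_in z')%g.
Proof.
rewrite cextM /coker3_in /= mulg1 raddfD; congr (_, _).
by rewrite addrA subrK addrAC.
Qed.

Lemma coker3_in_basis g h :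
  (coker3_in (basisZ (g, h)) * clift univ_cocycleP (g * h) =
   clift univ_cocycleP g * clift univ_cocycleP h)%g.
Proof.
rewrite !cextM /= mul1g addr0 cocycle1l ?subrK ?add0r //.
exact: univ_cocycleP.
Qed.

Definition derived_class (z : freeZ (T * T)) : abel S :=
  abel_pi S (coker3_in z).

Fact derived_class_is_nmod_morphism : nmod_morphism derived_class.
Proof.
have cD u v : derived_class (u + v) = derived_class u + derived_class v.
  by rewrite /derived_class coker3_inD abel_piD.
by split=> //; apply: (addrI (derived_class 0)); rewrite -cD !addr0.
Qed.

HB.instance Definition _ :=
  GRing.isNmodMorphism.Build _ _ derived_class derived_class_is_nmod_morphism.

(** The chain $(g, h)$ is the defect $s(g) s(h) s(gh)^(-1)$ of the section $s$ of
   $E \to T$, and becomes $s(g) + s(h) - s(gh)$ when $E$ is made abelian; this is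
   the image of its boundary under the additive extension of $s$. *)
Lemma derived_classE z : derived_class z =
  extendZ (fun g => abel_pi S (clift univ_cocycleP g)) (bar_d2 z).
Proof.
set s := fun g : T => abel_pi S (clift univ_cocycleP g).
rewrite [LHS]eq_extendZ [RHS](@eq_extendZ _ _ (extendZ s \o @bar_d2 T)).
apply: eq_bigr => -[g h] _; congr (_ *~ _).
rewrite /= /bar_d2 extendZ_basis raddfD raddfB /= !extendZ_basis.
have := congr1 (abel_pi S) (coker3_in_basis g h).
rewrite !abel_piD -[abel_pi S (coker3_in _)]/(derived_class _).
by move/(canRL (addrK _)) ->; rewrite [RHS]addrAC; congr (_ - _); rewrite addrC.
Qed.

Lemma cycle_in_derived z : bar_d2 z = 0 ->
  exists w, wedge_cext univ_cocycleP w = coker3_in z.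
Proof.
move=> dz; apply/(abel_pi_eq0 S).
by rewrite -/(derived_class z) derived_classE dz raddf0.
Qed.

(** The second homology group is a subgroup of $[E, E]$, which is an image of the
   exterior square. *)
Theorem H2_expq q : (forall w : ext_square T, w ^+ q = 1)%g ->
  forall v : H2 T, v *+ q = 0.
Proof.
move=> wq; elim/quotW=> z.
have /eqP dz : bar_d2 (val z) == 0 := valP z.
have [w wE] := cycle_in_derived dz.
have inX n : coker3_in (val z *+ n) = (coker3_in (val z) ^+ n)%g.
  elim: n => [|n IHn]; last by rewrite mulrS coker3_inD IHn expgS.
  by rewrite mulr0n expg0 cext1 /coker3_in raddf0 sub0r.
have : coker3_in (val z *+ q) = 1%g.
  by rewrite inX -wE -(gmulfXn (wedge_cext univ_cocycleP)) wq gmulf1.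
rewrite cext1 => /(congr1 fst)/= /(canRL (subrK _)); rewrite addNr.
move=> /coker3_pi_eq0 zq.
have zB : z *+ q \in boundary2 (G := T).
  by have [b db] := zq; apply/asboolP; exists b; rewrite db raddfMn.
pose Q := Quotient.quot (GRing.ZmodClosed.clone (Z2 T) (boundary2 (G := T)) _).
suff : \pi_Q (z *+ q) = 0 by rewrite raddfMn.
by apply/eqP; rewrite -[0](raddf0 \pi_Q) -Quotient.idealrBE subr0.
Qed.

End SchurMultiplier.

Lemma least_pos_dvdn P n : 0 < n -> P n ->
  (forall a b, P a -> P b -> P (a %% b)) -> least_pos P %| n.
Proof.
move=> n0 Pn Pmod; rewrite /least_pos; case: pselect => [exP|[]]; last first.
  by exists n; rewrite n0; apply/asboolP.
case: ex_minnP => e /andP[e0 /asboolP Pe] e_min.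
rewrite /dvdn; case: posnP => // r0.
have := e_min (n %% e); rewrite r0 => /(_ _)/=.
have -> : `[<P (n %% e)>] by apply/asboolP/Pmod.
by rewrite leqNgt ltn_mod e0 => /(_ isT).
Qed.

Lemma gexponent_dvdn (H : groupType) n :
  0 < n -> (forall x : H, x ^+ n = 1)%g -> gexponent H %| n.
Proof.
move=> n0 xn; apply: least_pos_dvdn => // a b xa xb x.
by have := xa x; rewrite {1}(divn_eq a b) expgnDr mulnC expgnA xb expg1n mul1g.
Qed.

Lemma zexponent_dvdn (V : zmodType) n :
  0 < n -> (forall x : V, x *+ n = 0)%R -> zexponent V %| n.
Proof.
move=> n0 xn; apply: least_pos_dvdn => // a b xa xb x.
by have := xa x; rewrite {1}(divn_eq a b) mulrnDr mulnC mulrnA xb mul0rn add0r.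
Qed.

Theorem theorem2p5 (p : nat) (gT : finGroupType) (G : {group gT})
    (p_prime : prime p) (p_odd : odd p) (pG : (p.-group G)%g)
    (metabelian_G : abelian G^`(1)%g) (class_G : nil_class G <= 2 * p - 1) :
  gexponent (ext_square [subg G]) %| exponent G /\
  zexponent (H2 [subg G]) %| exponent G.
Proof.
have p_gt1 := prime_gt1 p_prime.
have isoG : G \isog [set: [subg G]] := isog_subg G.
have exp_gt0 : 0 < exponent G := exponent_gt0 G.
have expS (x : [subg G]) : (x ^+ exponent G = 1)%g.
  by rewrite (exponent_isog isoG) expg_exponent ?inE.
have wq (w : ext_square [subg G]) : (w ^+ exponent G = 1)%g.
  apply: (ext_square_expq p_prime p_odd _ expS).
  - by rewrite pnat_exponent.
  - by rewrite -(isog_abelian (gFisog _ isoG)).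
  - have nilG := pgroup_nil pG.
    have -> : (2 * p = (2 * p - 1).+1)%N by lia.
    apply/lcn_nil_classP; first by rewrite -(isog_nil isoG).
    by rewrite -(isog_nil_class isoG).
by split; [apply: gexponent_dvdn | apply/zexponent_dvdn/H2_expq].
Qed.
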